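(* Let $\mathbb{K}$ be a field, let $\Delta$ be a simplicial complex and let $\sigma=\{u_{\tau_1},\dots,u_{\tau_r}\}$ be a nonempty face of the barycentric subdivision $\mathcal{B}(\Delta)$, for some nonempty faces $\tau_1\subsetneq\dots\subsetneq\tau_r$ of $\Delta$. Then $$h(\mathcal{B}(\Delta),\sigma)=h(\Delta,\tau_r)+\{|\tau_r|-r\}.$$
   Context: Simplicial complexes are sets of subsets of a finite vertex set closed under taking subsets. The barycentric subdivision $\mathcal{B}(\Delta)$ is the complex on vertex set $\{u_\sigma:\sigma\in\Delta\setminus\{\emptyset\}\}$ whose faces are the sets $\{u_{\sigma_1},\dots,u_{\sigma_r}\}$ with $\sigma_1\subsetneq\dots\subsetneq\sigma_r$ (including the empty face). For a face $\sigma$ of $\Delta$, $\mathrm{link}_\Delta\sigma=\{\tau\in\Delta:\sigma\cap\tau=\emptyset,\sigma\cup\tau\in\Delta\}$, and $h(\Delta,\sigma)=\{i\in\mathbb{Z}:\widetilde H_i(\mathrm{link}_\Delta\sigma)\ne0\}$, where $\widetilde H_i$ is reduced simplicial homology with coefficients in $\mathbb{K}$ (with $\widetilde H_{-1}(\{\emptyset\})=\mathbb{K}$). Sets of integers are added by $A+B=\{i+j:i\in A,j\in B\}$ (empty if $A$ or $B$ is empty). *)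

(* Defs.v *)
From HB Require Import structures.
(* classical_sets comes first, so that the unqualified names shared with finset
   (set0, setU, ...) refer to finite sets. *)
From mathcomp Require Import classical_sets.
From mathcomp Require Import all_boot all_algebra.

Set Implicit Arguments.
Unset Strict Implicit.
Unset Printing Implicit Defensive.

Import GRing.Theory.
Local Open Scope ring_scope.

Definition simplicial_complex (V : finType) (Delta : {set {set V}}) : Prop :=
  forall sigma tau : {set V},
    sigma \in Delta -> tau \subset sigma -> tau \in Delta.

Definition link (V : finType) (Delta : {set {set V}}) (sigma : {set V}) :
    {set {set V}} :=
  [set tau in Delta | (sigma :&: tau == set0) && (sigma :|: tau \in Delta)].

Definition strict_chain (V : finType) (s : seq {set V}) : bool :=
  sorted (fun A B : {set V} => A \proper B) s.

(* The vertex u_sigma is sigma itself, so the subdivision of a complex on V is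
   a complex on {set V}. *)
Definition barycentric_subdivision (V : finType) (Delta : {set {set V}}) :
    {set {set {set V}}} :=
  [set S : {set {set V}} |
    [exists t : #|S|.-tuple {set V},
      [&& all (fun sigma => (sigma \in Delta) && (sigma != set0)) t,
          strict_chain t & S == [set:: t]]]].

Lemma link_complex (V : finType) (Delta : {set {set V}}) (sigma : {set V}) :
  simplicial_complex Delta -> simplicial_complex (link Delta sigma).
Proof.
move=> hD a b; rewrite !inE => /and3P[aD /eqP sa0 saD] ba.
rewrite (hD a b) //= (hD _ (sigma :|: b) saD) ?setUS // andbT.
by rewrite -subset0 -sa0 setIS.
Qed.

Lemma barycentric_subdivision_complex (V : finType) (Delta : {set {set V}}) :
  simplicial_complex (barycentric_subdivision Delta).
Proof.
move=> S T; rewrite !inE => /existsP[t /and3P[tD st /eqP/setP St]] TS.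
have propT : transitive (fun A B : {set V} => A \proper B).
  by move=> y x z; apply: proper_trans.
have ut : uniq t.
  by apply: (sorted_uniq propT _ st) => x; rewrite properxx.
pose s := [seq x <- t | x \in T].
have Ts : T = [set:: s].
  apply/setP=> x; rewrite inE mem_filter; case: (boolP (x \in T)) => //= xT.
  by have := subsetP TS x xT; have := St x; rewrite inE => -> ->.
have szs : size s == #|T|.
  rewrite Ts cardsE; apply/eqP/esym/card_uniqP; exact: filter_uniq.
apply/existsP; exists (Tuple szs); apply/and3P; split.
- by apply/allP=> x; rewrite mem_filter => /andP[_] /(allP tD).
- exact: sorted_filter.
- exact/eqP.
Qed.

Section Homology.
Variables (K : fieldType) (V : finType).

Definition chain := {ffun {set V} -> K^o}.
HB.instance Definition _ := Vector.on chain.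

Definition elementary_chain (sigma : {set V}) : chain :=
  [ffun rho => (rho == sigma)%:R].

(* Vertices are ordered by enum_rank; faces are oriented accordingly. *)
Definition vertex_position (sigma : {set V}) (v : V) : nat :=
  #|[set w in sigma | (enum_rank w < enum_rank v)%N]|.

(* The boundary of a vertex is the elementary chain of the empty face, so the
   chain complex below is the augmented one. *)
Definition boundary_face (sigma : {set V}) : chain :=
  \sum_(v in sigma)
    (-1) ^+ vertex_position sigma v *: elementary_chain (sigma :\ v).

Definition boundary_fun (c : chain) : chain :=
  \sum_(sigma : {set V}) c sigma *: boundary_face sigma.

Fact boundary_fun_linear : linear boundary_fun.
Proof.
move=> a c d; rewrite /boundary_fun scaler_sumr -big_split /=.
by apply: eq_bigr => s _; rewrite !ffunE scalerDl scalerA.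
Qed.
HB.instance Definition _ :=
  GRing.isLinear.Build K chain chain _ boundary_fun boundary_fun_linear.

Definition boundary : 'End(chain) := linfun boundary_fun.

Variable Delta : {set {set V}}.

Definition faces (i : int) : {set {set V}} :=
  [set sigma in Delta | #|sigma|%:Z == i + 1].

Definition chains (i : int) : {vspace chain} :=
  <<[seq elementary_chain sigma | sigma in faces i]>>%VS.

Definition cycles (i : int) : {vspace chain} := (chains i :&: lker boundary)%VS.

Definition boundaries (i : int) : {vspace chain} :=
  (boundary @: chains (i + 1)%R)%VS.

(* The boundaries viewed inside the space of cycles, so that reduced_homology
   is the quotient of cycles by boundaries. *)
Definition boundaries_in_cycles (i : int) : {vspace subvs_of (cycles i)} :=
  (linfun (vsval : subvs_of (cycles i) -> chain) @^-1: boundaries i)%VS.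

Definition reduced_homology (i : int) : zmodType :=
  Quotient.quot (boundaries_in_cycles i).

End Homology.

Definition h (K : fieldType) (V : finType) (Delta : {set {set V}})
    (sigma : {set V}) : set int :=
  [set i : int |
    exists x : reduced_homology K (link Delta sigma) i, x != 0]%classic.

Definition sumset (A B : set int) : set int :=
  [set i + j | i in A & j in B]%classic.

(* Main.v *)
(* Deleting faces that a vertex matches in pairs (s, u |: s) does not change
   reduced homology; and if X minus a vertex m is acyclic, then
   H_(i+1)(X) = H_i(link m).  The link of a chain s in the subdivision consists
   of the chains of faces comparable to all of s.  If s has a gap A < B with
   |B \ A| >= 2 and v in B \ A, take m = B \ v: without m the link is
   contractible (push every x in the gap to v |: x, then cone from v |: A), so
   adding m to s lowers the degree of homology by one.  After |T| - r such
   steps, T the top of s, the chain is a full flag and its link consists of the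
   chains of faces properly containing T; successive stellar subdivisions, each
   a matching up and a matching down, compare it with link T. *)
Require Import Defs.
From mathcomp Require Import classical_sets boolp.
From mathcomp Require Import all_boot all_algebra.
From mathcomp Require Import ring zify.

Set Implicit Arguments.
Unset Strict Implicit.
Unset Printing Implicit Defensive.

Import GRing.Theory.
Local Open Scope ring_scope.

(** * Chains with abstract incidence numbers *)

Section Chains.
Variables (K : fieldType) (V : finType).
Implicit Types (e : {set V} -> V -> K) (c d : {set V} -> K) (s r : {set V}).
Implicit Types (X Y : {set {set V}}) (u v w : V) (k : nat).

(** Abstract boundary signs. The second clause makes the two ways of deleting [v] and [w] cancel,
    and nonvanishing lets cones be normalized. Keeping [e] arbitrary makes the same arguments
    available for any vertex order and for signs pulled back along an injection. *)
Definition incidence e :=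
  (forall s v, v \in s -> e s v != 0) /\
  (forall s v w, v \in s -> w \in s -> v != w ->
     e s v * e (s :\ v) w = - (e s w * e (s :\ w) v)).

(** The usual boundary read coefficientwise, as a sum over the cofaces of [r]; chains are then plain
    functions on all subsets. *)
Definition bd e c r : K := \sum_(v | v \notin r) e (v |: r) v * c (v |: r).

Definition supported X k c := forall s, c s != 0 -> s \in X /\ #|s| = k.

(* Indexed by the size k of faces, so this is H_(k-1)(X) = 0. *)
Definition exact_at e X k :=
  forall c, supported X k c -> bd e c =1 (fun=> 0) ->
    exists2 d, supported X k.+1 d & bd e d =1 c.

Lemma supported0 X k : supported X k (fun=> 0).
Proof. by move=> s /eqP. Qed.

Lemma supportedD X k c d :
  supported X k c -> supported X k d -> supported X k (fun s => c s + d s).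
Proof.
move=> hc hd s; have [->|/hc //] := eqVneq (c s) 0.
by rewrite add0r => /hd.
Qed.

Lemma supportedN X k c : supported X k c -> supported X k (fun s => - c s).
Proof. by move=> hc s; rewrite oppr_eq0 => /hc. Qed.

Lemma supportedS X Y k c :
  X \subset Y -> supported X k c -> supported Y k c.
Proof. by move=> /subsetP XY hc s /hc[/XY]. Qed.

Lemma supported_notin X k c s : supported X k c -> s \notin X -> c s = 0.
Proof. by move=> hc sX; apply/eqP; apply: contraNT sX => /hc[]. Qed.

Lemma eq_bd e c d : c =1 d -> bd e c =1 bd e d.
Proof. by move=> cd r; apply: eq_bigr => v _; rewrite cd. Qed.

Lemma bd0 e r : bd e (fun=> 0) r = 0.
Proof. by rewrite /bd big1 // => v _; rewrite mulr0. Qed.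

Lemma bdD e c d r : bd e (fun s => c s + d s) r = bd e c r + bd e d r.
Proof. by rewrite /bd -big_split; apply: eq_bigr => v _; rewrite mulrDr. Qed.

Lemma bdN e c r : bd e (fun s => - c s) r = - bd e c r.
Proof. by rewrite /bd -sumrN; apply: eq_bigr => v _; rewrite mulrN. Qed.

Lemma bdB e c d r : bd e (fun s => c s - d s) r = bd e c r - bd e d r.
Proof. by rewrite bdD bdN. Qed.

Lemma supported_bd e X k c : simplicial_complex X ->
  supported X k.+1 c -> supported X k (bd e c).
Proof.
move=> hX hc r; apply: contra_neqP => hr.
rewrite /bd big1 // => v vr; have [->|/hc[vX]] := eqVneq (c (v |: r)) 0.
  by rewrite mulr0.
rewrite cardsU1 vr => -[kr]; case: hr; split=> //.
exact: hX vX (subsetUr _ _).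
Qed.

Lemma incidenceU e r v w : incidence e -> v \notin r -> w \notin r -> v != w ->
  e (v |: (w |: r)) v * e (w |: r) w = - (e (v |: (w |: r)) w * e (v |: r) v).
Proof.
move=> [_ he] vr wr vw.
have := he (v |: (w |: r)) v w; rewrite !inE !eqxx orbT => /(_ isT isT vw).
have -> : (v |: (w |: r)) :\ v = w |: r.
  by rewrite setU1K // !inE (negPf vw).
by rewrite setUCA setU1K // !inE eq_sym (negPf vw).
Qed.

(** The terms at (v, w) and (w, v) cancel. Pairing them by rank, instead of showing that the sum is
    its own opposite, covers characteristic 2 as well. *)
Lemma antisym_sum0 (F : V -> V -> K) (P : rel V) :
  (forall v w, P v w = P w v) -> (forall v, ~~ P v v) ->
  (forall v w, P v w -> F v w = - F w v) ->
  \sum_v \sum_(w | P v w) F v w = 0.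
Proof.
move=> Psym Pirr Fanti; rewrite pair_big_dep /=.
rewrite (bigID (fun p => enum_rank p.1 < enum_rank p.2)%N) /=.
rewrite [X in _ + X](reindex_onto (fun p : V * V => (p.2, p.1))
  (fun p => (p.2, p.1))) /=; last by case.
rewrite [X in _ + X](eq_bigl (fun p : V * V =>
  P p.1 p.2 && (enum_rank p.1 < enum_rank p.2)%N)).
  by rewrite -big_split big1 // => p /andP[/Fanti -> _] /=; rewrite addNr.
move=> [v w] /=; rewrite eqxx andbT Psym -leqNgt leq_eqVlt.
have [<-|vw] := eqVneq v w; first by rewrite (negPf (Pirr v)).
by rewrite (inj_eq val_inj) (inj_eq enum_rank_inj) (negPf vw).
Qed.

Lemma bd_bd e c r : incidence e -> bd e (bd e c) r = 0.
Proof.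
move=> he; rewrite /bd big_mkcond /=.
pose F v w := e (v |: r) v * (e (w |: (v |: r)) w * c (w |: (v |: r))).
pose P v w := [&& v \notin r, w \notin r & v != w].
transitivity (\sum_v \sum_(w | P v w) F v w).
  apply: eq_bigr => v _; rewrite /P; case: ifP => vr /=; last by rewrite big_pred0.
  rewrite mulr_sumr; apply: eq_bigl => w.
  by rewrite !inE negb_or eq_sym andbC.
apply: antisym_sum0 => [v w|v|v w /and3P[vr wr vw]].
- by rewrite /P eq_sym andbCA.
- by rewrite /P eqxx !andbF.
- rewrite /F !mulrA [e (v |: r) v * _]mulrC incidenceU // 1?eq_sym //.
  by rewrite (setUCA [set v]) mulNr [e _ v * _]mulrC.
Qed.

(** * Cones and collapses *)

Definition cone e u c s : K := if u \in s then (e s u)^-1 * c (s :\ u) else 0.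

(** On the full simplex, joining with [u] is a contracting homotopy. If [u] is not in [r], only the
    summand adding [u] survives; if it is, the summands adding another vertex cancel between the two
    terms by [incidenceU]. *)
Lemma bd_cone e u c r : incidence e ->
  bd e (cone e u c) r + cone e u (bd e c) r = c r.
Proof.
move=> he; have [e0 _] := he.
rewrite /cone; case: ifPn => ur; last first.
  rewrite addr0 /bd (bigD1 u) //= big1 ?addr0 => [|v /andP[vr vu]].
    by rewrite setU11 setU1K // mulVKf // e0 ?setU11.
  by rewrite !inE eq_sym (negPf vu) (negPf ur) mulr0.
have [x ux ->] : exists2 x : {set V}, u \notin x & r = u |: x.
  by exists (r :\ u); rewrite ?setD1K // !inE eqxx.
have ru := setU11 u x.
rewrite setU1K // /bd [X in _ + _ * X](bigD1 u) //= mulrDr mulKf ?e0 //.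
rewrite addrCA mulr_sumr [X in _ + (X + _)](eq_bigl (fun v => (v \notin x) && (v != u))).
  rewrite -big_split /= big1 ?addr0 // => v /andP[vx vu].
  rewrite setUCA setU11 setU1K; last by rewrite !inE eq_sym negb_or vu.
  have vuP := incidenceU he vx ux vu.
  have E : e (u |: (v |: x)) v = - (e (u |: (v |: x)) u * e (v |: x) v) / e (u |: x) u.
    by apply: canRL (mulfK _) _; rewrite ?e0 ?setU11 // setUCA.
  rewrite E; have a0 := e0 _ _ ru; have b0 : e (u |: (v |: x)) u != 0 by rewrite e0 ?setU11.
  by field; rewrite a0 b0.
by move=> v; rewrite !inE negb_or andbC.
Qed.

Definition restrict X c s : K := if s \in X then c s else 0.

Lemma restrictE X c s : c s = restrict X c s + restrict (~: X) c s.
Proof. by rewrite /restrict inE; case: ifP; rewrite /= ?addr0 ?add0r. Qed.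

(* The faces of X outside Y are matched in pairs s, u |: s with u \notin s. *)
Section Collapse.
Variables (e : {set V} -> V -> K) (X Y : {set {set V}}) (u : V).
Hypotheses (he : incidence e) (hX : simplicial_complex X).
Hypotheses (hY : simplicial_complex Y) (YX : Y \subset X).
Hypothesis addu : forall s, s \in X -> s \notin Y -> u |: s \in X.
Hypothesis delu : forall s, s \in X -> s \notin Y -> s :\ u \notin Y.

Lemma supported_cone_restrict k c : supported X k c ->
  supported (X :\: Y) k.+1 (cone e u (restrict (~: Y) c)).
Proof.
move=> hc s; rewrite /cone /restrict inE.
case: ifP => us; last by rewrite eqxx.
case: ifPn => suY; last by rewrite mulr0 eqxx.
rewrite mulf_eq0 => /norP[_ /hc[suX <-]]; rewrite inE.
rewrite -(setD1K us) addu // andbT cardsU1 setD11 setU1K ?setD11 //; split => //.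
by apply: contraNN suY => /hY; apply; rewrite subsetUr.
Qed.

(** By [bd_cone], the new value at a face [s] outside [Y] is that of [cone e u (bd e c')], with [c']
    the part of [c] outside [Y]. This vanishes: [s :\ u] is also outside [Y], where [bd e c] is
    zero, and no coface of it lies in [Y]. The boundary need only vanish outside [Y], so the lemma
    applies to cycles of [X] and also to fillings in [X] of cycles of [Y]. *)
Lemma push_off k c : supported X k c ->
  (forall s, s \notin Y -> bd e c s = 0) ->
  supported Y k (fun s => c s - bd e (cone e u (restrict (~: Y) c)) s).
Proof.
move=> hc dc0 s; set c' := restrict _ _.
have hX' : supported X k (fun s => c s - bd e (cone e u c') s).
  apply: (supportedD hc (supportedN _)); apply: (supported_bd hX).
  by apply: supportedS (supported_cone_restrict hc); apply: subsetDl.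
move=> nz; have [sX sk] : s \in X /\ #|s| = k by exact: hX'.
split=> //; apply: contra_neqT nz => sY.
have -> : c s = c' s by rewrite /c' /restrict inE sY.
rewrite -{1}(bd_cone u c' s he) addrAC subrr add0r /cone; case: ifP => // us.
have := dc0 _ (delu sX sY); rewrite (eq_bd _ (restrictE (~: Y) c)) bdD.
rewrite [X in _ + X](_ : _ = 0) ?addr0 => [->|]; first by rewrite mulr0.
rewrite setCK /bd big1 // => v _; rewrite /restrict; case: ifP => vY.
  by case/negP: (delu sX sY); apply: hY vY _; apply: subsetUr.
by rewrite mulr0.
Qed.

(** Downwards, a filling in [X] is pushed into [Y] without changing its boundary. Upwards, a cycle
    of [X] is pushed into [Y], filled there, and the cone that was subtracted is added back to the
    filling. *)
Lemma exact_collapse k : exact_at e X k <-> exact_at e Y k.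
Proof.
split=> H c hc dc.
- have [d hd dE] := H c (supportedS YX hc) dc.
  have hcY s : s \notin Y -> bd e d s = 0 by move/(supported_notin hc); rewrite dE.
  exists (fun s => d s - bd e (cone e u (restrict (~: Y) d)) s).
    exact: push_off hd hcY.
  by move=> r; rewrite bdB bd_bd // subr0.
- have hc' := push_off hc (fun s _ => dc s).
  have [|d hd dE] := H _ hc'; first by move=> r; rewrite bdB bd_bd // subr0.
  exists (fun s => d s + cone e u (restrict (~: Y) c) s).
    apply: supportedD (supportedS YX hd) _.
    by apply: supportedS (supported_cone_restrict hc); apply: subsetDl.
  by move=> r; rewrite bdD dE subrK.
Qed.

End Collapse.

Lemma exact_set0 e k : exact_at e set0 k.
Proof.
move=> c hc _; exists (fun=> 0) => [|r]; first exact: supported0.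
by rewrite bd0; apply/esym/(supported_notin hc); rewrite inE.
Qed.

(** The empty face is matched too, with the vertex [u], so the collapse ends at the void complex and
    not at the complex of the empty face. *)
Lemma exact_cone e X u k : incidence e -> simplicial_complex X ->
  (forall s, s \in X -> u |: s \in X) -> exact_at e X k.
Proof.
move=> he hX hu; apply/(@exact_collapse e X set0 u) => //.
- by move=> s t; rewrite inE.
- by rewrite sub0set.
- by move=> s sX _; apply: hu.
- by move=> s; rewrite !inE.
- exact: exact_set0.
Qed.

(** * Deletion and link of a vertex *)

Section Shift.
Variables (e : {set V} -> V -> K) (X : {set {set V}}) (m : V).
Hypotheses (he : incidence e) (hX : simplicial_complex X).

Let del := [set s in X | m \notin s].
Let lk := link X [set m].

(** The quotient of the chains of [X] by those of [del], identified with the chains of [lk] one size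
    lower. The factor [e (m |: s) m] makes it anticommute with [bd]. *)
Let proj c s : K := if m \in s then 0 else e (m |: s) m * c (m |: s).

Let proj_bd c s : proj (bd e c) s = - bd e (proj c) s.
Proof.
rewrite /proj; case: ifPn => ms.
  by rewrite /bd big1 ?oppr0 // => v _; rewrite !inE ms orbT mulr0.
rewrite /bd [X in - X](bigD1 m) //= setU11 mulr0 add0r mulr_sumr -sumrN.
apply: eq_big => [v|v]; first by rewrite !inE negb_or andbC.
rewrite !inE negb_or => /andP[vm vs].
rewrite [m == v]eq_sym (negPf vm) (negPf ms) /= !mulrA.
by rewrite [e (m |: s) m * _]mulrC incidenceU // mulNr [e _ m * _]mulrC (setUCA [set m]).
Qed.

Let projE c s : m \in s -> proj c (s :\ m) = e s m * c s.
Proof. by move=> ms; rewrite /proj !inE eqxx /= setD1K. Qed.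

Let proj_cone k z : supported lk k z -> proj (cone e m z) =1 z.
Proof.
move=> hz s; rewrite /proj /cone setU11; case: ifPn => ms.
  by apply/esym/(supported_notin hz); rewrite !inE setI_eq0 disjoints1 ms andbF.
by rewrite setU1K // mulVKf //; have [e0 _] := he; rewrite e0 ?setU11.
Qed.

Let supported_proj k c : supported X k.+1 c -> supported lk k (proj c).
Proof.
move=> hc s; rewrite /proj; case: ifPn => ms; first by rewrite eqxx.
rewrite mulf_eq0 => /norP[_ /hc[msX]]; rewrite cardsU1 ms => -[sk].
by rewrite !inE setI_eq0 disjoints1 ms msX (hX msX) ?subsetUr.
Qed.

Let supported_lift k z : supported lk k z -> supported X k.+1 (cone e m z).
Proof.
move=> hz s; rewrite /cone; case: ifPn => ms; last by rewrite eqxx.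
rewrite mulf_eq0 => /norP[_ /hz[]]; rewrite !inE => /and3P[_ _].
by rewrite setD1K // => sX <-; rewrite (cardsD1 m s) ms.
Qed.

Let supported_del k c :
  supported X k c -> proj c =1 (fun=> 0) -> supported del k c.
Proof.
move=> hc pc s cs; have [sX sk] := hc s cs; rewrite !inE sX; split=> //=.
apply: contraNN cs => ms; have := pc (s :\ m); rewrite projE // => /eqP.
by rewrite mulf_eq0; have [e0 _] := he; rewrite (negPf (e0 _ _ ms)).
Qed.

Let projD c d s : proj (fun s => c s + d s) s = proj c s + proj d s.
Proof. by rewrite /proj; case: ifP; rewrite ?addr0 // mulrDr. Qed.

Let del_sub : del \subset X.
Proof. by apply/subsetP => s; rewrite inE => /andP[]. Qed.

Let proj_del k c : supported del k c -> proj c =1 (fun=> 0).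
Proof.
move=> hc s; rewrite /proj; case: ifP => // _.
by rewrite (supported_notin hc) ?mulr0 // !inE eqxx andbF.
Qed.

Hypothesis del_exact : forall k, exact_at e del k.

(** The only face of size 0 is the empty one, which avoids [m], so acyclicity of [del] settles this
    degree. *)
Lemma exact_at_0 : exact_at e X 0.
Proof.
move=> c hc dc; have [|d hd dE] := @del_exact 0 c _ dc.
- move=> s cs; have [sX s0] := hc s cs; split=> //.
  by rewrite inE sX /= (cards0_eq s0) inE.
- by exists d => //; apply: supportedS hd.
Qed.

(** The long exact sequence of [X] and [del], chased by hand: [del] being acyclic, [X] has the
    homology of the quotient, which is that of [lk] moved up by one. *)
Lemma exact_shift k : exact_at e X k.+1 <-> exact_at e lk k.
Proof.
split=> H.
(* Lift [z] by coning from [m]. The boundary of the lift projects to zero, so it lies in [del] and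
   is filled there by [w]; a filling of the cycle [y - w] projects, up to sign, to a filling of
   [z]. *)
- move=> z hz dz; pose y := cone e m z.
  have hy : supported X k.+1 y := supported_lift hz.
  have hdy : supported del k (bd e y).
    apply: supported_del (supported_bd hX hy) _ => s.
    by rewrite proj_bd (eq_bd _ (proj_cone hz)) dz oppr0.
  have [r|w hw wE] := del_exact hdy; first exact: bd_bd.
  have [||u hu uE] := H (fun s => y s - w s).
  + by apply: supportedD hy _; apply: supportedN; apply: supportedS hw.
  + by move=> r; rewrite bdB wE subrr.
  exists (fun s => - proj u s).
    exact/supportedN/supported_proj.
  move=> r; rewrite bdN -proj_bd -(proj_cone hz).
  transitivity (proj (fun s => y s - w s) r); last first.
    rewrite projD -[RHS]addr0; congr (_ + _).
    by rewrite (proj_del (supportedN hw)).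
  by rewrite /proj; case: ifP; rewrite ?uE.
- move=> c hc dc.
  have [||z hz zE] := H (proj c); first exact: supported_proj.
    move=> r; apply/eqP; rewrite -oppr_eq0 -proj_bd /proj.
    by case: ifP; rewrite ?dc ?mulr0.
  (* Since [proj] anticommutes with [bd], adding [bd e y] to [c] kills its projection; the sum is a
     cycle of [del]. *)
  pose y := cone e m z.
  have hy : supported X k.+2 y := supported_lift hz.
  have [||w hw wE] := @del_exact k.+1 (fun s => c s + bd e y s).
  + apply: supported_del => [|s]; first exact: supportedD hc (supported_bd hX hy).
    by rewrite projD proj_bd (eq_bd _ (proj_cone hz)) zE subrr.
  + by move=> r; rewrite bdD dc bd_bd // addr0.
  exists (fun s => w s - y s).
    by apply: supportedD (supportedN hy); apply: supportedS hw.
  by move=> r; rewrite bdB wE addrK.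
Qed.

End Shift.

(** * Independence of the incidence numbers *)

Section Rescale.
Variables (e1 e2 : {set V} -> V -> K).
Hypotheses (he1 : incidence e1) (he2 : incidence e2).

Let q s v := e2 s v / e1 s v.

(** The product of the ratios [q] met while emptying [s] one vertex at a time; [n] is fuel, to be
    taken equal to [#|s|]. *)
Let Fixpoint scale n s : K :=
  if n is n'.+1 then
    if [pick v in s] is Some v then scale n' (s :\ v) * q s v else 1
  else 1.

Let q_neq0 s v : v \in s -> q s v != 0.
Proof.
by have [[h1 _] [h2 _]] := (he1, he2); move=> vs; rewrite mulf_neq0 ?invr_eq0 ?h1 ?h2.
Qed.

Let scale_neq0 n s : scale n s != 0.
Proof.
elim: n s => [|n IH] s /=; first exact: oner_neq0.
by case: pickP => [v vs|_]; rewrite ?oner_neq0 // mulf_neq0 ?q_neq0.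
Qed.

(** The product does not depend on the vertex removed first. Removing [v] then [w], or [w] then [v],
    gives the same ratio, because the signs from antisymmetry of [e1] and [e2] cancel in the
    quotient. *)
Let scaleD1 n s v : #|s| = n.+1 -> v \in s -> scale n.+1 s = scale n (s :\ v) * q s v.
Proof.
elim: n s v => [|n IH] s v sn vs /=.
all: case: pickP => [w ws|/(_ v)]; last by rewrite vs.
all: have [->//|vw] := eqVneq v w.
  by move: sn; rewrite (cardsD1 v) vs (cardsD1 w) !inE eq_sym vw ws.
have sz x : x \in s -> #|s :\ x| = n.+1.
  by move=> xs; move: sn; rewrite (cardsD1 x) xs => -[].
rewrite -/(scale n.+1 (s :\ v)) -/(scale n.+1 (s :\ w)).
rewrite (IH _ v) ?sz // ?inE ?vw ?vs // (IH (s :\ v) w) ?sz // ?inE 1?eq_sym ?vw ?ws //.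
rewrite !setDDl [[set w] :|: _]setUC -!mulrA; congr (_ * _).
have [[h1 a1] [h2 a2]] := (he1, he2).
have /h1 n1 := vs; have /h1 n2 := ws.
have /h1 n3 : v \in s :\ w by rewrite !inE vw.
have /h1 n4 : w \in s :\ v by rewrite !inE eq_sym vw.
rewrite [LHS]mulrA [RHS]mulrA !mulf_div.
rewrite [e2 (s :\ w) v * _]mulrC [e1 (s :\ w) v * _]mulrC.
rewrite [e2 (s :\ v) w * _]mulrC [e1 (s :\ v) w * _]mulrC.
by rewrite (a2 s v w) // (a1 s v w) // invrN mulrNN.
Qed.

(* Makes homology independent of the vertex order used for the signs, hence
   invariant under relabeling. *)
Lemma incidence_rescale : exists2 g : {set V} -> K, (forall s, g s != 0) &
  forall s v, v \notin s -> e1 (v |: s) v * g (v |: s) = g s * e2 (v |: s) v.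
Proof.
exists (fun s => scale #|s| s) => [s|s v vs]; first exact: scale_neq0.
rewrite cardsU1 vs (@scaleD1 #|s| _ v) ?setU11 ?cardsU1 ?vs // setU1K // /q.
have [h1 _] := he1; have h : e1 (v |: s) v != 0 by rewrite h1 ?setU11.
by rewrite mulrCA [e1 _ _ * _]mulrC divfK.
Qed.

End Rescale.

End Chains.

(** * Invariance under injective relabeling of vertices *)

Section Relabel.
Variables (K : fieldType) (V W : finType) (f : V -> W).
Variables (e : {set V} -> V -> K) (e' : {set W} -> W -> K).
Hypotheses (f_inj : injective f) (he : incidence e) (he' : incidence e').
Implicit Types (s : {set V}) (r : {set W}) (X : {set {set V}}).

Let incidence_pull : incidence (fun s v => e' (f @: s) (f v)).
Proof.
have imD1 s v : f @: (s :\ v) = (f @: s) :\ f v.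
  apply/setP=> w; rewrite !inE; apply/imsetP/andP => [[x]|[wv /imsetP[x xs wx]]].
    by rewrite !inE => /andP[xv xs] ->; rewrite (inj_eq f_inj) xv imset_f.
  by exists x; rewrite // !inE xs andbT; apply: contraNneq wv => <-; rewrite wx.
have [h0 ha] := he'; split=> [s v vs|s v w vs ws vw]; first by rewrite h0 ?imset_f.
by rewrite !imD1 ha ?imset_f // (inj_eq f_inj).
Qed.

Let preimK s : f @^-1: (f @: s) = s.
Proof. by apply/setP => v; rewrite inE (mem_imset _ _ f_inj). Qed.

(** Pulling [e'] back along [f] gives a second incidence system on [V]; the factors [g] relating it
    to [e] turn the bijection of faces into an isomorphism of chain complexes, with inverse maps
    [pull] and [push]. *)
Lemma exact_relabel X k :
  exact_at e X k <-> exact_at e' [set f @: s | s : {set V} in X] k.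
Proof.
have [g g0 gE] := incidence_rescale he incidence_pull.
set Y := [set _ | _ in X].
pose pull (c : {set W} -> K) s := g s * c (f @: s).
(* The test says that [r] lies in the image of [f]; every other set gets coefficient 0. *)
pose push (d : {set V} -> K) r :=
  if r == f @: (f @^-1: r) then (g (f @^-1: r))^-1 * d (f @^-1: r) else 0.
have pushE d s : push d (f @: s) = (g s)^-1 * d s by rewrite /push preimK eqxx.
have pushK d : pull (push d) =1 d by move=> s; rewrite /pull pushE mulVKf.
have hpull j c : supported Y j c -> supported X j (pull c).
  move=> hc s; rewrite mulf_eq0 => /norP[_ /hc[/imsetP[t tX /(imset_inj f_inj) ->]]].
  by rewrite card_imset.
have hpush j d : supported X j d -> supported Y j (push d).
  move=> hd r; rewrite /push; case: ifPn => [/eqP rE|_]; last by rewrite eqxx.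
  rewrite mulf_eq0 => /norP[_ /hd[sX <-]]; rewrite rE imset_f //.
  by rewrite card_imset // preimK.
have bd_pull j c s : supported Y j c -> bd e (pull c) s = g s * bd e' c (f @: s).
  move=> hc; rewrite /bd /pull mulr_sumr.
  rewrite [RHS](bigID (mem (f @: (~: s)))) /= [X in _ + X]big1 ?addr0.
    rewrite (eq_bigl (mem (f @: (~: s)))); last first.
      move=> w /=; rewrite andb_idl // => /imsetP[v vs ->].
      by rewrite (mem_imset _ _ f_inj) //; rewrite inE in vs.
    rewrite big_imset /=; last by move=> ? ? _ _; apply: f_inj.
    apply: eq_big => [v|v vs]; first by rewrite inE.
    by rewrite mulrA gE // !imsetU1 !mulrA.
  move=> w /andP[wfs wns]; rewrite (supported_notin hc) ?mulr0 //.
  apply: contra wns => /imsetP[t _ wt].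
  have /imsetP[v vt wv] : w \in f @: t by rewrite -wt setU11.
  by rewrite wv imset_f // inE; apply: contra wfs => vs; rewrite wv imset_f.
have bd_out j c r : supported Y j c -> r != f @: (f @^-1: r) -> bd e' c r = 0.
  move=> hc rE; rewrite /bd big1 // => w wr.
  rewrite (supported_notin hc) ?mulr0 //; apply: contra rE => /imsetP[t _ wt].
  rewrite eqEsubset; apply/andP; split; apply/subsetP => x xr; last first.
    by case/imsetP: xr => v; rewrite inE => vr ->.
  have /imsetP[v vt xv] : x \in f @: t by rewrite -wt inE xr orbT.
  by rewrite xv imset_f // inE -xv.
split=> H c hc dc.
- have [||d hd dE] := H (pull c); first exact: hpull.
    by move=> s; rewrite (bd_pull _ _ _ hc) dc mulr0.
  exists (push d); first exact: hpush.
  move=> r; have [rE|rE] := eqVneq r (f @: (f @^-1: r)); last first.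
    rewrite (bd_out _ _ _ (hpush _ _ hd)) //; apply/esym/(supported_notin hc).
    by apply: contra rE => /imsetP[t _ ->]; rewrite preimK.
  apply: (mulfI (g0 (f @^-1: r))); rewrite {2}rE -(bd_pull _ _ _ (hpush _ _ hd)).
  by rewrite (eq_bd _ (pushK d)) dE /pull -rE.
- have hpc := hpush _ _ hc.
  have [||d hd dE] := H (push c) => //.
    move=> r; have [rE|rE] := eqVneq r (f @: (f @^-1: r)); last exact: bd_out hpc _.
    apply: (mulfI (g0 (f @^-1: r))); rewrite mulr0 {2}rE -(bd_pull _ _ _ hpc).
    by rewrite (eq_bd _ (pushK c)) dc.
  exists (pull d); first exact: hpull.
  by move=> s; rewrite (bd_pull _ _ _ hd) dE pushE mulVKf.
Qed.

End Relabel.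

(** * Order complexes and links in the subdivision *)

Definition face_sign (K : fieldType) (V : finType) (s : {set V}) (v : V) : K :=
  (-1) ^+ vertex_position s v.

(** Deleting [v] lowers the position of [w] exactly when [v] precedes [w]. This happens for just one
    order of the pair, whence the sign. *)
Lemma incidence_face_sign (K : fieldType) (V : finType) :
  incidence (@face_sign K V).
Proof.
have posD1 (s : {set V}) v w : v \in s -> vertex_position s w =
    ((enum_rank v < enum_rank w) + vertex_position (s :\ v) w)%N.
  move=> vs; rewrite /vertex_position (cardsD1 v) inE vs /=; congr (_ + _)%N.
  by apply: eq_card => x; rewrite !inE andbA.
split=> [s v _|s v w vs ws vw]; first by rewrite signr_eq0.
rewrite /face_sign (posD1 s v w) // (posD1 s w v) // !exprD.
have : (enum_rank v < enum_rank w)%N = ~~ (enum_rank w < enum_rank v)%N.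
  by rewrite -leqNgt [RHS]leq_eqVlt (inj_eq val_inj) (inj_eq enum_rank_inj) (negPf vw).
by move=> ->; case: (_ < _)%N; rewrite /= ?expr1 ?expr0; ring.
Qed.

Section Cliques.
Variables (K : fieldType) (U : finType) (cmp : rel U).
Variable e : {set U} -> U -> K.
Hypotheses (cmp_refl : reflexive cmp) (cmp_sym : symmetric cmp).
Hypothesis he : incidence e.
Implicit Types (P S : {set U}) (x y z m : U).

(** The flag complex of the relation on [P]. For [nested] it is the order complex of a family of
    sets: a chain is a set of pairwise comparable members. *)
Definition cliques P : {set {set U}} :=
  [set S : {set U} | (S \subset P) && [forall x in S, forall y in S, cmp x y]].

Lemma cliquesP P S :
  reflect (S \subset P /\ {in S &, forall x y, cmp x y}) (S \in cliques P).
Proof.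
rewrite inE; apply: (iffP andP) => -[SP h]; split=> //.
  by move=> x y xS yS; move/forall_inP: h => /(_ x xS)/forall_inP/(_ y yS).
by apply/forall_inP => x xS; apply/forall_inP => y; apply: h.
Qed.

Lemma cliques_complex P : simplicial_complex (cliques P).
Proof.
move=> S T /cliquesP[SP h] TS; apply/cliquesP; split.
  exact: subset_trans SP.
by move=> x y xT yT; apply: h; apply: (subsetP TS).
Qed.

Lemma cliquesU1 P S x : x \in P -> S \in cliques P ->
  {in S, forall y, cmp x y} -> x |: S \in cliques P.
Proof.
move=> xP /cliquesP[SP h] xS; apply/cliquesP; split.
  by rewrite subUset sub1set xP.
move=> a b; rewrite !inE => /predU1P[->|aS] /predU1P[->|bS] //.
- exact: xS.
- by rewrite cmp_sym xS.
- exact: h.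
Qed.

(** The faces lost by deleting [x] are those containing [x]; toggling [y] matches them in pairs,
    since whatever is comparable to [x] is comparable to [y]. *)
Lemma exact_dominated P x y k : x \in P -> y \in P -> x != y ->
  {in P, forall z, cmp x z -> cmp y z} ->
  exact_at e (cliques P) k <-> exact_at e (cliques (P :\ x)) k.
Proof.
move=> xP yP xy dom; have hsub : cliques (P :\ x) \subset cliques P.
  apply/subsetP => S /cliquesP[SP h]; apply/cliquesP; split=> //.
  exact: subset_trans SP (subsetDl _ _).
have xS S : S \in cliques P -> S \notin cliques (P :\ x) -> x \in S.
  move=> /cliquesP[SP h]; apply: contraNT => xS; apply/cliquesP.
  by rewrite subsetD1 SP.
apply: (@exact_collapse _ _ e _ _ y) => //; try exact: cliques_complex.
  move=> S SP /(xS _ SP) hx; apply: cliquesU1 => // z zS.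
  by case/cliquesP: SP => /subsetP SP h; apply: dom; [apply: SP | apply: h].
move=> S SP /(xS _ SP) hx; apply/cliquesP => -[/subsetP/(_ x)].
by rewrite !inE xy hx eqxx => /(_ isT).
Qed.

Lemma exact_cliques_cone P y k : y \in P -> {in P, forall z, cmp y z} ->
  exact_at e (cliques P) k.
Proof.
move=> yP hy; apply: (@exact_cone _ _ e _ y) => //; first exact: cliques_complex.
move=> S SP; apply: cliquesU1 => // z zS; apply: hy.
by case/cliquesP: SP => /subsetP SP _; apply: SP.
Qed.

Lemma link_cliques P S : S \in cliques P ->
  link (cliques P) S =
    cliques [set x in P | (x \notin S) && [forall y in S, cmp y x]].
Proof.
move=> /cliquesP[SP hS]; apply/setP => T; rewrite inE.
apply/and3P/cliquesP => [[/cliquesP[TP hT] ST /cliquesP[_ hST]]|[/subsetP TP hT]].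
  split=> //; apply/subsetP => x xT; rewrite inE (subsetP TP) //=; apply/andP; split.
    by apply: contraL ST => xS; apply/set0Pn; exists x; rewrite inE xS.
  by apply/forall_inP => y yS; rewrite hST // inE ?xT ?yS ?orbT.
have TP' : T \subset P by apply/subsetP => x /TP; rewrite inE => /andP[].
have cST x y : x \in S -> y \in T -> cmp x y.
  by move=> xS /TP; rewrite inE => /and3P[_ _ /forall_inP]; apply.
split; first exact/cliquesP.
  rewrite setI_eq0 disjoint_sym disjoints_subset; apply/subsetP => x /TP.
  by rewrite !inE => /and3P[].
apply/cliquesP; split; first by rewrite subUset SP.
move=> x y; rewrite !inE => /orP[xS|xT] /orP[yS|yT].
- exact: hS.
- exact: cST.
- by rewrite cmp_sym; apply: cST.
- exact: hT.
Qed.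

Lemma cliquesD1 P m : [set S in cliques P | m \notin S] = cliques (P :\ m).
Proof.
apply/setP => S; rewrite inE; apply/andP/cliquesP.
  by case=> /cliquesP[SP h] mS; rewrite subsetD1 SP.
by rewrite subsetD1 => -[/andP[SP mS] h]; split=> //; apply/cliquesP.
Qed.

End Cliques.

Section Subdivision.
Variables (V : finType) (D : {set {set V}}).
Implicit Types (A B C : {set V}).

Definition nested : rel {set V} := fun A B => (A \subset B) || (B \subset A).

Lemma nested_refl : reflexive nested.
Proof. by move=> A; rewrite /nested subxx. Qed.

Lemma nested_sym : symmetric nested.
Proof. by move=> A B; rewrite /nested orbC. Qed.

Lemma strict_chain_nested (t : seq {set V}) :
  strict_chain t -> {in t &, forall A B, nested A B}.
Proof.
have propT : transitive (fun A B : {set V} => A \proper B).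
  by move=> B A C; apply: proper_trans.
rewrite /strict_chain (sorted_pairwise propT) => h A B At Bt.
have [i it <-] := nthP set0 At; have [j jt <-] := nthP set0 Bt.
move/(pairwiseP set0): h => h.
rewrite /nested; have [ij|ji|->] := ltngtP i j; last by rewrite subxx.
  by rewrite (proper_sub (h _ _ it jt ij)).
by rewrite (proper_sub (h _ _ jt it ji)) orbT.
Qed.

Lemma barycentric_subdivisionE :
  barycentric_subdivision D = cliques nested (D :\ set0).
Proof.
apply/setP => S; rewrite inE; apply/existsP/cliquesP.
  case=> t /and3P[/allP tD /strict_chain_nested ht /eqP ->]; split.
    by apply/subsetP => A; rewrite !inE andbC => /tD.
  by move=> A B; rewrite !inE; apply: ht.
(* Among nested sets cardinality decides inclusion, so sorting by it produces the chain. *)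
case=> /subsetP SP hS; pose t := sort (fun A B : {set V} => #|A| <= #|B|)%N (enum S).
have tS A : (A \in t) = (A \in S) by rewrite mem_sort mem_enum.
have szt : size t == #|S| by rewrite size_sort -cardE.
have ut : uniq t by rewrite sort_uniq enum_uniq.
exists (Tuple szt); apply/and3P; split.
- by apply/allP => A; rewrite tS => /SP; rewrite !inE andbC.
- have leT : transitive (fun A B : {set V} => #|A| <= #|B|)%N.
    by move=> B A C; apply: leq_trans.
  have := sort_sorted (fun A B : {set V} => leq_total #|A| #|B|) (enum S).
  rewrite -/t (sorted_pairwise leT) => pt.
  apply: pairwise_sorted; move: pt ut; rewrite uniq_pairwise => pt ut.
  have := @sub_in_pairwise _ (mem S) (fun A B : {set V} => (#|A| <= #|B|)%N && (A != B))
    (fun A B : {set V} => A \proper B).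
  apply.
  + move=> A B AS BS /= /andP[AB nAB]; rewrite properEneq nAB /=.
    case/orP: (hS A B AS BS) => // BA.
    by rewrite (eqP (_ : B == A)) // eqEcard BA AB.
  + by apply/allP => A; rewrite tS.
  + by rewrite pairwise_relI pt.
- by apply/eqP/setP => A; rewrite inE tS.
Qed.

End Subdivision.

Arguments nested {V} A B.

(** * Filling the gaps of a chain *)

Section Gaps.
Variables (K : fieldType) (V : finType) (D : {set {set V}}).
Variable e : {set {set V}} -> {set V} -> K.
Hypotheses (hD : simplicial_complex D) (he : incidence e).
Implicit Types (A B C T x m : {set V}) (s P Q : {set {set V}}).

(** The vertices of the link of [s] in the subdivision. *)
Definition comparable_faces s : {set {set V}} :=
  [set x in D :\ set0 | (x \notin s) && [forall y in s, nested y x]].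

Lemma comparable_facesP s x :
  reflect [/\ x \in D, x != set0, x \notin s & {in s, forall y, nested y x}]
    (x \in comparable_faces s).
Proof.
rewrite !inE; apply: (iffP and3P) => [[/andP[x0 xD] xs /forall_inP]|[xD x0 xs h]].
  by split.
by split; [apply/andP | | apply/forall_inP].
Qed.

(** [A] is the predecessor of [B] in the chain, the empty set standing in for it when [B] is the
    smallest member. *)
Definition gap s A B : Prop :=
  [/\ B \in s, A \subset B, (A \in s) || (A == set0),
      (#|A| + 2 <= #|B|)%N & {in s, forall C, C \subset A \/ B \subset C}].

(** Distinct nested sets have distinct cardinalities, here between 1 and [#|T|]. *)
Lemma card_clique_le s T : s \in cliques nested (D :\ set0) ->
  {in s, forall C, C \subset T} -> (#|s| <= #|T|)%N.
Proof.
move=> /cliquesP[/subsetP sD hs] sT.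
rewrite cardE -(size_map (fun C : {set V} => #|C|) (enum s)) -(size_iota 1 #|T|).
apply: uniq_leq_size.
  rewrite map_inj_in_uniq ?enum_uniq // => A B; rewrite !mem_enum => As Bs /= AB.
  by case/orP: (hs A B As Bs) => h; [|apply/esym]; apply/eqP; rewrite eqEcard h AB leqnn.
move=> _ /mapP[C + ->]; rewrite mem_enum mem_iota => Cs.
have := sD C Cs; rewrite !inE -card_gt0 => /andP[-> _] /=.
by rewrite add1n ltnS subset_leq_card // sT.
Qed.

(** Without a gap, cardinalities climb from 0 by at most one at each member, so a member [B] has at
    least [#|B|] members of [s] inside it, itself included. For [T] this contradicts the bound on
    [#|s|]. *)
Lemma exists_gap s T : s \in cliques nested (D :\ set0) -> T \in s ->
  (#|s| < #|T|)%N -> exists A B, gap s A B.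
Proof.
move=> /cliquesP[/subsetP sD hs] Ts sT.
have H n B : (#|B| <= n)%N -> B \in s -> (exists A B, gap s A B) \/
    (#|B| <= #|[set C in s | C \subset B]|)%N.
  elim: n B => [|n IH] B Bn Bs; first by right; move: Bn; rewrite leqn0 => /eqP ->.
  (* Including [set0] makes a largest element [A] exist even when [B] is minimal in [s]. *)
  pose below := set0 |: [set C in s | C \proper B].
  have b0 : set0 \in below by rewrite !inE eqxx.
  case: (@arg_maxnP _ set0 (mem below) (fun C => #|C|) b0) => A /=.
  move=> Abelow Amax.
  have AB : A \subset B.
    move: Abelow; rewrite !inE => /predU1P[->|/andP[_ /proper_sub //]].
    exact: sub0set.
  have As : (A \in s) || (A == set0).
    by move: Abelow; rewrite !inE => /predU1P[->|/andP[->//]]; rewrite eqxx orbT.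
  have [A2|A2] := leqP (#|A| + 2) #|B|.
    left; exists A, B; split=> // C Cs; case/orP: (hs C B Cs Bs) => CB; last by right.
    have [BC|BC] := boolP (B \subset C); first by right.
    left; have Cbelow : C \in below by rewrite !inE Cs /= properE CB BC orbT.
    have CA := Amax C Cbelow.
    case/orP: As => [As|/eqP A0]; last first.
      by move: CA; rewrite A0 cards0 leqn0 cards_eq0 => /eqP ->.
    case/orP: (hs C A Cs As) => // AC.
    by rewrite (eqP (_ : A == C)) // eqEcard AC.
  have {A2} A2 : (#|B| <= #|A|.+1)%N by lia.
  have {}As : A \in s /\ A \proper B \/ A = set0.
    by move: Abelow; rewrite !inE => /predU1P[->|/andP[]]; [right | left].
  have BB : B \in [set C in s | C \subset B] by rewrite inE Bs subxx.
  case: As => [[As pAB]|A0]; last first.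
    right; apply: leq_trans A2 _; rewrite A0 cards0 card_gt0.
    by apply/set0Pn; exists B.
  have [||g|IHA] := IH A => //; first by rewrite -ltnS (leq_trans _ Bn) // proper_card.
    by left.
  right; apply: leq_trans A2 _; rewrite (cardsD1 B) BB add1n ltnS.
  apply: leq_trans IHA (subset_leq_card _); apply/subsetP => C.
  rewrite !inE => /andP[-> CA]; rewrite (subset_trans CA AB) !andbT.
  by apply: contraTneq pAB => <-; rewrite properE CA andbF.
have [//|] := H #|T| T (leqnn _) Ts.
rewrite leqNgt => /negP[]; apply: leq_ltn_trans sT; apply: subset_leq_card.
by apply/subsetP => C; rewrite inE => /andP[].
Qed.

Section OneGap.
Variables (s : {set {set V}}) (A B : {set V}) (v : V).
Hypotheses (hs : s \in cliques nested (D :\ set0)) (hg : gap s A B).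
Hypothesis hv : v \in B :\: A.

Let m := B :\ v.

Let vA : v \notin A. Proof. by move: hv; rewrite inE => /andP[]. Qed.
Let vB : v \in B. Proof. by move: hv; rewrite inE => /andP[]. Qed.
Let cardB : #|B| = #|m|.+1. Proof. by rewrite /m (cardsD1 v B) vB. Qed.
Let BD : B \in D.
Proof.
case/cliquesP: hs => /subsetP/(_ B) h _; have [/h] := hg.
by rewrite !inE => /andP[].
Qed.

Lemma gap_mem : m \in comparable_faces s.
Proof.
have [Bs AB As AB2 AsB] := hg; apply/comparable_facesP; split.
- exact: hD BD (subsetDl _ _).
- by rewrite -card_gt0; lia.
- apply/negP => ms; case: (AsB m ms) => /subset_leq_card; lia.
- move=> C Cs; rewrite /nested; case: (AsB C Cs) => [CA|BC]; apply/orP; [left|right].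
    by rewrite subsetD1 (subset_trans CA AB); apply: contraNN vA; apply: (subsetP CA).
  exact: subset_trans (subsetDl _ _) BC.
Qed.

Let P := comparable_faces s :\ m.

(** The condition [x != m] keeps [v |: x] different from [B], which belongs to [s] and so is no
    vertex of the link. This is why [m] has to be deleted first. *)
Let addv_P x : A \subset x -> x \subset B -> v \notin x -> x != m -> v |: x \in P.
Proof.
have [Bs AB As AB2 AsB] := hg; move=> Ax xB vx xm.
have vxB : v |: x \subset B by rewrite subUset sub1set vB.
rewrite inE; apply/andP; split.
  by rewrite inE; apply/eqP => /setP/(_ v); rewrite !inE eqxx.
apply/comparable_facesP; split; first exact: hD BD vxB.
- by apply/set0Pn; exists v; rewrite setU11.
- apply/negP => /AsB[/subsetP/(_ v)|Bvx].
    by rewrite setU11 (negPf vA) => /(_ isT).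
  by case/eqP: xm; rewrite /m (eqP (_ : B == v |: x)) ?setU1K // eqEsubset Bvx.
- move=> C /AsB[CA|BC]; rewrite /nested; apply/orP; [left|right].
    by apply: subset_trans (subset_trans CA Ax) _; apply: subsetUr.
  exact: subset_trans vxB BC.
Qed.

Let bad Q : {set {set V}} :=
  [set x in Q | [&& A \subset x, x \subset B & v \notin x]].

(** The bad faces are removed largest first. A largest bad [x] is dominated by [v |: x]: a face
    strictly containing [x] is not bad, so it contains [B], or lies inside [B] and contains [v].
    Once no bad face is left, all faces are comparable to [v |: A]. *)
Lemma exact_gap k : exact_at e (cliques nested P) k.
Proof.
have [Bs AB As AB2 AsB] := hg.
have cmpB x : x \in P -> (B \subset x) || (x \subset B).
  by rewrite inE => /andP[_ /comparable_facesP[_ _ _ /(_ B Bs)]].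
have cmpA x : x \in P -> (A \subset x) || (x \subset A).
  rewrite inE => /andP[_ /comparable_facesP[_ _ _ h]].
  by case/orP: As => [/h //|/eqP ->]; rewrite sub0set.
(* The invariant says that only bad faces have been removed; sets containing [v], such as [v |: x],
   are therefore still in [Q]. *)
suff H n Q : #|bad Q| = n -> Q \subset P -> P :\: Q \subset bad P ->
    exact_at e (cliques nested Q) k.
  by apply: (H _ P erefl); rewrite ?setDv ?sub0set.
elim: n Q => [|n IH] Q badQ QP PQ.
  apply: (@exact_cliques_cone _ _ _ e (@nested_refl V) (@nested_sym V) he _ (v |: A)).
    apply: contraTT PQ => nQ; apply/subsetPn; exists (v |: A).
      rewrite inE nQ addv_P //; apply/eqP => Am; move: AB2; rewrite cardB Am; lia.
    by rewrite !inE eqxx !andbF.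
  move=> z zQ; rewrite /nested; have zP := subsetP QP _ zQ.
  case/orP: (cmpB z zP) => zB.
    by rewrite subUset sub1set (subsetP zB) // (subset_trans AB).
  case/orP: (cmpA z zP) => zA; last by rewrite (subset_trans zA) ?orbT // subsetUr.
  rewrite subUset zA sub1set andbT; case: (boolP (v \in z)) => //= vz.
  have : z \in bad Q by rewrite inE zQ zA zB.
  by rewrite (cards0_eq badQ) inE.
have [x0 x0bad] : exists x, x \in bad Q by apply/set0Pn; rewrite -card_gt0 badQ.
case: (@arg_maxnP _ x0 (mem (bad Q)) (fun x => #|x|) x0bad) => x /= xbad xmax.
have := xbad; rewrite inE => /and4P[xQ Ax xB vx]; have xP := subsetP QP _ xQ.
have xm : x != m by move: xP; rewrite !inE => /andP[].
have yQ : v |: x \in Q.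
  apply: contraTT PQ => nQ; apply/subsetPn; exists (v |: x).
    by rewrite inE nQ addv_P.
  by rewrite !inE eqxx !andbF.
apply/(@exact_dominated _ _ nested e (@nested_refl V) (@nested_sym V) he Q x (v |: x)) => //.
- by apply: contraNneq vx => ->; rewrite setU11.
- move=> z zQ; rewrite /nested => /orP[xz|zx]; last first.
    by rewrite (subset_trans zx) ?orbT // subsetUr.
  have zP := subsetP QP _ zQ; case/orP: (cmpB z zP) => zB.
    by rewrite subUset sub1set (subsetP zB) // xz.
  case: (boolP (v \in z)) => vz; first by rewrite subUset sub1set vz xz.
  have zbad : z \in bad Q by rewrite inE zQ zB vz (subset_trans Ax).
  rewrite (eqP (_ : x == z)) ?subsetUr ?orbT // eqEcard xz; exact: xmax.
- apply: IH.
  + have -> : bad (Q :\ x) = bad Q :\ x by apply/setP => z; rewrite !inE -!andbA.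
    by move: badQ; rewrite (cardsD1 x) xbad => -[].
  + exact: subset_trans (subsetDl _ _) QP.
  + apply/subsetP => z; rewrite !inE negb_and negbK => /andP[/predU1P[->|zQ]].
      by move=> _; move: xP; rewrite !inE => ->; rewrite Ax xB vx.
    by move=> zP; have := subsetP PQ z; rewrite !inE zQ zP; apply.
Qed.

End OneGap.

(** A comparable face not properly above [T] would lie inside [T] and extend [s] to a chain with
    more than [#|T|] members, against [card_clique_le]. *)
Lemma comparable_faces_full s T : s \in cliques nested (D :\ set0) ->
  T \in s -> {in s, forall C, C \subset T} -> #|T| = #|s| ->
  comparable_faces s = [set x in D | T \proper x].
Proof.
move=> hs Ts sT cT; apply/setP => x; rewrite inE; apply/comparable_facesP/andP.
  case=> xD x0 xs xc; split=> //; rewrite properE.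
  case/orP: (xc T Ts) => Tx; last first.
    have := @card_clique_le (x |: s) T; rewrite cardsU1 xs cT ltnn => H.
    suff: false by [].
    apply: H; first by apply: cliquesU1 => //; [exact: nested_refl|exact: nested_sym|
      rewrite !inE x0|move=> y /xc; rewrite nested_sym].
    by move=> C; rewrite !inE => /predU1P[->|/sT].
  rewrite Tx; apply: contra xs => xT.
  by rewrite (eqP (_ : x == T)) // eqEsubset xT.
case=> xD Tx; split=> //.
- rewrite -card_gt0; exact: leq_ltn_trans (proper_card Tx).
- by apply: contraTN Tx => /sT xT; rewrite properE xT andbF.
- by move=> C Cs; rewrite /nested (subset_trans (sT C Cs)) // proper_sub.
Qed.

(** Induction on the number [n] of steps missing from a full flag below [T]. Each gap filled by [m]
    shifts degrees by one, since the link of [m] inside the link of [s] is the link of [m |: s]; the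
    second conjunct records the degrees freed at the bottom, where homology vanishes. *)
Lemma exact_link_subdivision n s T : s \in cliques nested (D :\ set0) ->
  T \in s -> {in s, forall C, C \subset T} -> #|T| = (#|s| + n)%N ->
  (forall k, exact_at e (link (barycentric_subdivision D) s) (k + n) <->
     exact_at e (cliques nested [set x in D | T \proper x]) k) /\
  (forall k, (k < n)%N -> exact_at e (link (barycentric_subdivision D) s) k).
Proof.
rewrite barycentric_subdivisionE.
have linkE t : t \in cliques nested (D :\ set0) ->
    link (cliques nested (D :\ set0)) t = cliques nested (comparable_faces t).
  by move=> ht; rewrite link_cliques //; apply: nested_sym.
elim: n s => [|n IH] s hs Ts sT cT.
  split=> // k; rewrite addn0 linkE // (comparable_faces_full hs Ts sT) //.
  by rewrite cT addn0.
have [|A [B hg]] := exists_gap hs Ts; first by rewrite cT; lia.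
have [Bs AB As AB2 AsB] := hg.
have [v hv] : exists v, v \in B :\: A.
  apply/set0Pn; rewrite -card_gt0 cardsD (setIidPr AB); lia.
pose m := B :\ v; have mc : m \in comparable_faces s := gap_mem hs hg hv.
have /comparable_facesP[mD m0 ms mn] := mc.
have hms : m |: s \in cliques nested (D :\ set0).
  apply: cliquesU1 => //; [exact: nested_refl|exact: nested_sym|by rewrite !inE m0|].
  by move=> y /mn; rewrite nested_sym.
have linkm : link (cliques nested (comparable_faces s)) [set m] =
    cliques nested (comparable_faces (m |: s)).
  rewrite link_cliques; last 2 first.
  - exact: nested_sym.
  - apply/cliquesP; rewrite sub1set; split=> // x y; rewrite !inE => /eqP -> /eqP ->.
    exact: nested_refl.
  congr (cliques _ _); apply/setP => x; rewrite !inE; apply/idP/idP.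
    case/and3P=> /and3P[-> xs /forall_inP h1] xm /forall_inP h2; rewrite negb_or xs xm /=.
    by apply/forall_inP => y; rewrite !inE => /predU1P[->|/h1//]; rewrite h2 ?inE.
  rewrite negb_or => /and3P[-> /andP[-> ->] /forall_inP h]; rewrite /=.
  by apply/andP; split; apply/forall_inP => y ys; apply: h; rewrite !inE ?ys ?orbT //; move: ys; rewrite inE => ->.
have del k : exact_at e [set t in cliques nested (comparable_faces s) | m \notin t] k.
  by rewrite cliquesD1; apply: exact_gap hs hg hv k.
have shift k := exact_shift he (@cliques_complex _ nested (comparable_faces s)) del k.
have [||||IH1 IH2] := IH (m |: s) => //.
- by rewrite inE Ts orbT.
- move=> C; rewrite !inE => /predU1P[->|/sT //].
  exact: subset_trans (subsetDl _ _) (sT B Bs).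
- rewrite cardsU1 ms cT; lia.
rewrite (linkE s) // (linkE (m |: s)) // in IH1 IH2 *.
split=> [k|[|k] kn].
- by rewrite addnS; apply: iff_trans (shift _) _; rewrite linkm; apply: IH1.
- exact: exact_at_0 del.
- by apply/shift; rewrite linkm; apply: IH2.
Qed.

End Gaps.

(** * Stellar subdivisions *)

Section Stellar.
Variables (K : fieldType) (V : finType) (D : {set {set V}}) (T : {set V}).
Hypotheses (hD : simplicial_complex D) (TD : T \in D).
Implicit Types (r x y : {set V}) (F G : {set {set V}}).

(** Left vertices are original vertices of the link of [T]; right vertices are the new ones
    introduced by subdivision, each named by the face it subdivides. *)
Let W : finType := (V + {set V})%type.
Implicit Types (S : {set W}).

Let old S : {set V} := inl @^-1: S.
Let new S : {set {set V}} := inr @^-1: S.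

(* Barycentric subdivision as a sequence of stellar subdivisions: [mixed F F]
   is link D T with the faces t such that T :|: t \in F subdivided. *)
Definition mixed F G : {set {set W}} :=
  [set S : {set W} | [&& [disjoint old S & T], T :|: old S \in D, T :|: old S \notin F,
    new S \in cliques nested G & [forall r in new S, T :|: old S \subset r]]].

Lemma mixedP F G S :
  reflect [/\ [disjoint old S & T], T :|: old S \in D, T :|: old S \notin F,
      new S \in cliques nested G & {in new S, forall r, T :|: old S \subset r}]
    (S \in mixed F G).
Proof.
rewrite [X in reflect _ X]in_set; apply: (iffP and5P) => -[h1 h2 h3 h4 h5]; split=> //; exact/forall_inP.
Qed.

Let above := [set x in D | T \proper x].

Definition up_closed F : Prop :=
  F \subset above /\ {in F, forall x y, y \in D -> x \subset y -> y \in F}.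

Lemma mixed_complex F G : up_closed F -> simplicial_complex (mixed F G).
Proof.
case=> _ hF S S' /mixedP[dS DS FS cS hS] S'S.
have oS : old S' \subset old S by apply: preimsetS.
have nS : new S' \subset new S by apply: preimsetS.
apply/mixedP; split.
- exact: disjointWl dS.
- exact: hD DS (setUS _ oS).
- by apply: contra FS => /hF; apply; rewrite // setUS.
- exact: cliques_complex cS nS.
- by move=> r /(subsetP nS)/hS; apply: subset_trans; rewrite setUS.
Qed.

Lemma mixedS F F' G G' : F' \subset F -> G \subset G' -> mixed F G \subset mixed F' G'.
Proof.
move=> FF GG; apply/subsetP => S /mixedP[dS DS FS /cliquesP[cS1 cS2] hS].
apply/mixedP; split=> //; first by apply: contra FS; apply: (subsetP FF).
by apply/cliquesP; split=> //; apply: subset_trans cS1 GG.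
Qed.

Let oldU1l (v : V) S : old (inl v |: S) = v |: old S.
Proof. by apply/setP => w; rewrite !inE. Qed.
Let newU1l (v : V) S : new (inl v |: S) = new S.
Proof. by apply/setP => w; rewrite !inE. Qed.
Let oldU1r r S : old (inr r |: S) = old S.
Proof. by apply/setP => w; rewrite !inE. Qed.
Let newU1r r S : new (inr r |: S) = r |: new S.
Proof. by apply/setP => w; rewrite !inE. Qed.

(** The intermediate complex [mixed F (r |: F)] already has the vertex [r] but still keeps the face
    that it subdivides. The faces containing the new vertex are matched by toggling an old vertex
    [v] of [r] outside [T]; those with [T :|: old S = r] are matched by toggling the new vertex
    itself. *)
Lemma exact_stellar (e : {set W} -> W -> K) F r k : incidence e ->
  up_closed F -> up_closed (r |: F) -> r \notin F -> r \in above ->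
  exact_at e (mixed F F) k <-> exact_at e (mixed (r |: F) (r |: F)) k.
Proof.
move=> he hF hrF rF; rewrite inE => /andP[rD Tr]; have FrF := subsetUr [set r] F.
have [_ upF] := hF.
apply: (@iff_trans _ (exact_at e (mixed F (r |: F)) k)).
  have [_ [v vr vT]] := properP Tr.
  have hr S : S \in mixed F (r |: F) -> S \notin mixed F F -> inr r \in S.
    move=> /mixedP[dS DS FS /cliquesP[cS1 cS2] hS]; apply: contraNT => rS.
    apply/mixedP; split=> //; apply/cliquesP; split=> //.
    apply/subsetP => x xS; have := subsetP cS1 x xS; rewrite !inE => /predU1P[xr|//].
    by move: xS; rewrite inE xr (negPf rS).
  apply: iff_sym; apply: (@exact_collapse _ _ e _ _ (inl v)) => //.
  - exact: mixed_complex.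
  - exact: mixed_complex.
  - exact: mixedS.
  - move=> S SX SY; have rS := hr S SX SY.
    have /mixedP[dS DS FS cS hS] := SX; have /cliquesP[cS1 cS2] := cS.
    have rS' : r \in new S by rewrite inE.
    have sub : T :|: (v |: old S) \subset r.
      by rewrite setUCA subUset sub1set vr hS.
    apply/mixedP; rewrite oldU1l newU1l; split=> //.
    + by rewrite disjoints_subset subUset sub1set inE vT -disjoints_subset.
    + exact: hD rD sub.
    + by apply: contra rF => /upF; apply.
    (* Every new vertex [x] of [S] contains [r]: otherwise [x] would be a member of [F] inside [r],
       and [r] would be in [F] by upward closure. *)
    + move=> x xS; apply: (subset_trans sub).
      have := subsetP cS1 x xS; rewrite in_setU1 => /predU1P[->//|xF].
      case/orP: (cS2 x r xS rS') => // xr; case/negP: rF; exact: upF xF _ rD xr.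
  - move=> S SX SY; have rS := hr S SX SY.
    apply/mixedP => -[_ _ _ /cliquesP[/subsetP/(_ r) + _] _].
    by rewrite !inE rS => /(_ isT); apply/negP.
have hr S : S \in mixed F (r |: F) -> S \notin mixed (r |: F) (r |: F) ->
    T :|: old S = r.
  move=> /mixedP[dS DS FS cS hS] SY; apply/eqP; apply: contraNT SY => nr.
  by apply/mixedP; split=> //; rewrite in_setU1 negb_or nr.
apply: (@exact_collapse _ _ e _ _ (inr r)) => //.
- exact: mixed_complex.
- exact: mixed_complex.
- exact: mixedS.
- move=> S SX SY; have rS := hr S SX SY.
  have /mixedP[dS DS FS cS hS] := SX.
  apply/mixedP; rewrite oldU1r newU1r; split=> //.
    apply: cliquesU1 => //; [exact: nested_refl|exact: nested_sym|exact: setU11|].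
    by move=> x /hS xS; rewrite /nested -rS xS.
  by move=> x; rewrite in_setU1 => /predU1P[->|/hS //]; rewrite rS.
- move=> S SX SY; have rS := hr S SX SY; apply/mixedP => -[_ _ + _ _].
  have -> : old (S :\ inr r) = old S by apply/setP => w; rewrite !inE.
  by rewrite rS setU11.
Qed.

Lemma exact_mixed (e : {set W} -> W -> K) F k : incidence e -> up_closed F ->
  exact_at e (mixed F F) k <-> exact_at e (mixed set0 set0) k.
Proof.
move=> he; move Dn: #|F| => n; elim: n F Dn => [|n IH] F Fn hF.
  by rewrite (cards0_eq Fn).
have [r0 r0F] : exists r, r \in F by apply/set0Pn; rewrite -card_gt0 Fn.
(* Removing a member of least size keeps the family closed upwards; read forwards, larger faces are
   subdivided first. *)
case: (@arg_minnP _ r0 (mem F) (fun x => #|x|) r0F) => r /= rF rmin.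
have [FT upF] := hF.
have hFr : up_closed (F :\ r).
  split; first exact: subset_trans (subsetDl _ _) FT.
  move=> x; rewrite in_setD1 => /andP[xr xF] y yD xy; rewrite in_setD1 (upF x) // andbT.
  apply: contraNneq xr => yr; rewrite eqEcard -yr xy yr; exact: rmin.
apply: iff_trans (IH (F :\ r) _ hFr); last by move: Fn; rewrite (cardsD1 r) rF => -[].
apply: iff_sym; rewrite -{3 4}(setD1K rF).
by apply: exact_stellar; rewrite ?setD1K // ?(subsetP FT) // !inE eqxx.
Qed.

(** These are the two ends of the stellar process. With nothing subdivided there are no new
    vertices, leaving [link D T]; with all of [above] subdivided, [T :|: old S] must be [T], so no
    old vertices remain, only chains in [above]. *)
Lemma exact_link_cliques (e1 : {set V} -> V -> K) (e2 : {set {set V}} -> {set V} -> K) k :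
  incidence e1 -> incidence e2 ->
  exact_at e2 (cliques nested above) k <-> exact_at e1 (link D T) k.
Proof.
move=> he1 he2; pose e := @face_sign K W; have he : incidence e by apply: incidence_face_sign.
have oldI (t : {set V}) : old (inl @: t) = t.
  by apply/setP => v; rewrite inE mem_imset //; apply: inl_inj.
have newI (t : {set V}) : new (inl @: t) = set0.
  by apply/setP => v; rewrite !inE; apply/imsetP => -[].
have oldJ (t : {set {set V}}) : old (inr @: t) = set0.
  by apply/setP => v; rewrite !inE; apply/imsetP => -[].
have newJ (t : {set {set V}}) : new (inr @: t) = t.
  by apply/setP => v; rewrite inE mem_imset //; apply: inr_inj.
have up_above : up_closed above.
  split=> // x; rewrite inE => /andP[_ Tx] y yD xy; rewrite inE yD.
  exact: proper_sub_trans Tx xy.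
apply: iff_trans (exact_relabel (@inr_inj _ _) he2 he _ _) _.
apply: iff_trans _ (iff_sym (exact_relabel (@inl_inj _ _) he1 he _ _)).
have -> : [set [set inl x | x in s] | s : {set V} in link D T] = mixed set0 set0.
  apply/setP => S; apply/imsetP/mixedP => [[t tlk ->]|[dS DS _ /cliquesP[cS _] _]].
    have := tlk; rewrite inE oldI newI => /and3P[tD Tt TtD]; split; rewrite ?in_set0 //.
    - by rewrite disjoint_sym -setI_eq0.
    - by apply/cliquesP; split=> [|x]; rewrite ?sub0set ?inE.
    - by move=> x; rewrite inE.
  exists (old S).
    by rewrite !inE DS andbT (hD DS (subsetUr _ _)) setI_eq0 disjoint_sym.
  have nS : new S = set0 by apply/eqP; rewrite -subset0.
  apply/setP => -[v|r].
    by rewrite mem_imset ?inE //; apply: inl_inj.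
  have := in_set0 r; rewrite -nS inE => ->; apply/esym/imsetP => -[] //.
have -> : [set [set inr x | x in s] | s : {set {set V}} in cliques nested above] =
    mixed above above.
  apply/setP => S; apply/imsetP/mixedP => [[t tc ->]|[dS DS nS cS _]].
    rewrite oldJ newJ setU0; split=> //.
    - by rewrite disjoints_subset sub0set.
    - by rewrite inE properxx andbF.
    - move=> r rt; case/cliquesP: tc => /subsetP/(_ r rt).
      by rewrite inE => /andP[_ /proper_sub].
  exists (new S) => //.
  have oS : old S = set0.
    move: nS; rewrite inE DS properE subsetUl /= negbK => oT.
    apply/eqP; rewrite -subset0; apply/subsetP => v vS.
    have vT : v \in T by rewrite (subsetP oT) // in_setU vS orbT.
    by have := disjointFr dS vS; rewrite vT.
  apply/setP => -[v|r]; last by rewrite mem_imset ?inE //; apply: inr_inj.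
  have := in_set0 v; rewrite -oS inE => ->; apply/esym/imsetP => -[] //.
exact: exact_mixed.
Qed.

End Stellar.

(** * Reduced homology *)

Section Homology.
Variables (K : fieldType) (V : finType) (X : {set {set V}}).
Implicit Types (c : chain K V) (s r : {set V}) (i : int).

(** Exchanging the two sums turns the sum over faces with a chosen vertex into the sum over cofaces
    of [r]. *)
Lemma boundaryE c r : boundary K V c r = bd (@face_sign K V) c r.
Proof.
rewrite lfunE /= /boundary_fun sum_ffunE.
transitivity (\sum_(s : {set V}) \sum_(v in s) c s * (face_sign K s v * (r == s :\ v)%:R)).
  apply: eq_bigr => s _; rewrite !ffunE /boundary_face sum_ffunE scaler_sumr.
  by apply: eq_bigr => v _; rewrite !ffunE.
rewrite (exchange_big_dep predT) //= /bd [RHS]big_mkcond /=.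
apply: eq_bigr => v _; case: ifPn => vr.
  rewrite (bigD1 (v |: r)) ?setU11 //= setU1K // eqxx mulr1 big1 ?addr0 1?mulrC //.
  move=> s /andP[vs sr]; case: eqVneq => [rE|]; last by rewrite !mulr0.
  by case/eqP: sr; rewrite rE setD1K.
rewrite big1 // => s vs; case: eqVneq => [rE|]; last by rewrite !mulr0.
by case/negP: vr; rewrite rE !inE eqxx.
Qed.

Lemma chainE c : c = \sum_s c s *: elementary_chain K s.
Proof.
apply/ffunP => r; rewrite sum_ffunE (bigD1 r) //= !ffunE eqxx big1 ?addr0.
  by rewrite /GRing.scale /= mulr1.
by move=> s sr; rewrite !ffunE eq_sym (negPf sr) /GRing.scale /= mulr0.
Qed.

Lemma mem_chains i c :
  reflect (forall s, c s != 0 -> s \in faces X i) (c \in chains K X i).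
Proof.
apply: (iffP idP) => [+ s|h]; last first.
  rewrite [c]chainE; apply: memv_suml => s _.
  have [->|/h hs] := eqVneq (c s) 0; first by rewrite scale0r mem0v.
  by apply/memvZ/memv_span/imageP; exists s.
rewrite /chains -[X in <<X>>%VS]/(tval (in_tuple _)) => /coord_span ->.
rewrite sum_ffunE; apply: contraNT => sX; rewrite big1 // => j _.
rewrite ffunE; have := mem_nth 0 (ltn_ord j) => /imageP[r rX ->].
rewrite ffunE; case: eqVneq => [rs|_]; last by rewrite /GRing.scale /= mulr0.
by case/negP: sX; rewrite rs.
Qed.

Lemma mem_cycles i c :
  (c \in cycles K X i) = (c \in chains K X i) && (boundary K V c == 0).
Proof. by rewrite memv_cap memv_ker. Qed.

Lemma mem_boundaries i c : reflect
  (exists2 d, d \in chains K X (i + 1) & c = boundary K V d) (c \in boundaries K X i).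
Proof. exact: memv_imgP. Qed.

Lemma reduced_homology_neq0 i :
  (exists x : reduced_homology K X i, x != 0) <->
  (exists2 c, c \in cycles K X i & c \notin boundaries K X i).
Proof.
have piE (y : subvs_of (cycles K X i)) :
    (\pi_(reduced_homology K X i) y == 0)%qT = (vsval y \in boundaries K X i).
  by rewrite !piE Quotient.equivE subr0 -memv_preim lfunE.
split=> [[x]|[c cc cb]].
  rewrite -[x]reprK piE => h.
  exists (vsval (repr x)) => //; exact: subvsP.
exists (\pi_(reduced_homology K X i) (vsproj _ c))%qT.
by rewrite piE vsprojK.
Qed.

Lemma facesE i k s : i = k%:Z - 1 -> (s \in faces X i) = (s \in X) && (#|s| == k).
Proof. by move=> ->; rewrite inE subrK eqz_nat. Qed.

Lemma supportedP i k c : i = k%:Z - 1 ->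
  (c \in chains K X i) <-> supported X k c.
Proof.
move=> ik; split=> [/mem_chains h s /h|h].
  by rewrite (facesE _ ik) => /andP[sX /eqP].
by apply/mem_chains => s /h[sX sk]; rewrite (facesE _ ik) sX sk eqxx.
Qed.

Lemma homology_exactP i : (exists x : reduced_homology K X i, x != 0) <->
  exists2 k, i = k%:Z - 1 & ~ exact_at (@face_sign K V) X k.
Proof.
apply: iff_trans (reduced_homology_neq0 i) _; split=> [[c]|[k ik nex]].
  rewrite mem_cycles => /andP[cX /eqP dc] cb.
  (* A cycle that is not a boundary is nonzero, so some face has a nonzero coefficient and its size
     is [k]. This excludes degrees below -1. *)
  have [k ik] : exists k : nat, i = k%:Z - 1.
    have [c0|/existsNP[s /eqP cs]] := pselect (forall s, c s = 0).
      case/negP: cb; suff -> : c = 0 by apply: mem0v.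
      by apply/ffunP => s; rewrite c0 ffunE.
    have /mem_chains/(_ s cs) := cX; rewrite inE => /andP[_ /eqP si].
    by exists #|s|; rewrite si addrK.
  exists k => // /(_ c)[||d hd dE].
  - exact/(supportedP _ ik).
  - by move=> r; rewrite -boundaryE dc ffunE.
  case/negP: cb; apply/mem_boundaries.
  exists (finfun d : chain K V).
    have ik1 : i + 1 = k.+1%:Z - 1 by rewrite ik; lia.
    by apply/(supportedP _ ik1) => s; rewrite ffunE => /hd.
  apply/ffunP => r; rewrite boundaryE -dE; apply: eq_bd => s; by rewrite ffunE.
apply: contrapT => nc; apply: nex => c hc dc.
pose c' : chain K V := finfun c; have c'E : @eqfun K _ c' c by move=> s; rewrite ffunE.
have [cb|cb] := boolP (c' \in boundaries K X i); last first.
  case: nc; exists c' => //; rewrite mem_cycles; apply/andP; split.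
    by apply/(supportedP _ ik) => s; rewrite c'E => /hc.
  by apply/eqP/ffunP => r; rewrite boundaryE (eq_bd _ c'E) dc ffunE.
case/mem_boundaries: cb => d dX cd; exists d.
  by apply/(@supportedP (i + 1)) => //; rewrite ik; lia.
by move=> r; rewrite -boundaryE -cd c'E.
Qed.

End Homology.

Theorem corollary6p28 (K : fieldType) (V : finType) (Delta : {set {set V}})
    (hDelta : simplicial_complex Delta)
    (sigma : {set {set V}})
    (hsigma : sigma \in barycentric_subdivision Delta)
    (hsigma0 : sigma != set0)
    (r : nat) (tau : r.-tuple {set V})
    (htau : forall t, t \in tau -> t \in Delta /\ t != set0)
    (hchain : strict_chain tau)
    (hsigmatau : sigma = [set:: tau]) :
  h K (barycentric_subdivision Delta) sigma =
    sumset (h K Delta (last set0 tau))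
           [set #|last set0 tau|%:Z - r%:Z]%classic.
Proof.
set T := last set0 tau.
have propT : transitive (fun A B : {set V} => A \proper B).
  by move=> B A C; apply: proper_trans.
have hs : sigma \in cliques nested (Delta :\ set0) by rewrite -barycentric_subdivisionE.
have cs : #|sigma| = r.
  rewrite hsigmatau cardsE -[RHS](size_tuple tau); apply/card_uniqP.
  by apply: (sorted_uniq propT _ hchain) => x; rewrite properxx.
have [Ts sT] : T \in sigma /\ {in sigma, forall C : {set V}, C \subset T}.
  (* This ensures that [T] is a member of the chain and not the default value of [last]. *)
  have tau0 : tval tau != [::].
    by apply: contraNneq hsigma0; rewrite hsigmatau => ->; apply/eqP/setP => C; rewrite !inE.
  rewrite /T hsigmatau; move: tau0 hchain; case/lastP: (tval tau) => // t x _.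
  rewrite last_rcons /strict_chain (sorted_pairwise propT) pairwise_rcons => /andP[/allP tx _].
  split=> [|C]; rewrite inE mem_rcons inE ?eqxx //.
  by case/predU1P => [->//|/tx/proper_sub].
have TD : T \in Delta.
  by have /cliquesP[/subsetP/(_ T Ts)] := hs; rewrite !inE => /andP[].
have := card_clique_le hs sT; rewrite cs => rT.
have [n cT] : exists n, #|T| = (r + n)%N by exists (#|T| - r)%N; rewrite subnKC.
have [E E0] : (forall k,
      exact_at (@face_sign K {set V}) (link (barycentric_subdivision Delta) sigma) (k + n) <->
      exact_at (@face_sign K V) (link Delta T) k) /\
    (forall k, (k < n)%N ->
      exact_at (@face_sign K {set V}) (link (barycentric_subdivision Delta) sigma) k).
  have cT' : #|T| = (#|sigma| + n)%N by rewrite cs.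
  have [E E0] := exact_link_subdivision hDelta (@incidence_face_sign K _) hs Ts sT cT'.
  split=> // k; apply: iff_trans (E k) _.
  by apply: exact_link_cliques => //; apply: incidence_face_sign.
apply/seteqP; split=> i.
- move/homology_exactP => [k -> nex].
  (* Degrees below [n] carry no homology by [E0], so subtracting [n] stays within the natural
     numbers. *)
  have [j kj] : exists j, k = (j + n)%N.
    by exists (k - n)%N; rewrite subnK // leqNgt; apply/negP => /E0.
  exists (j%:Z - 1); last by exists (#|T|%:Z - r%:Z) => //; rewrite cT kj; lia.
  by apply/homology_exactP; exists j => // /E; rewrite -kj.
- move=> [_ /homology_exactP[j -> nex] [_ -> <-]].
  apply/homology_exactP; exists (j + n)%N; first by rewrite cT; lia.
  by move/E.
Qed.
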